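(* Let $(M,\boldsymbol{p})$ be a projective manifold of dimension $n\ge2$ and let $r\ge1$ be an integer. For $k\in\Gamma(S^rT^*M(2r))$ let $K_{C_1\cdots C_r}=Z_{C_1}{}^{c_1}\cdots Z_{C_r}{}^{c_r}k_{c_1\cdots c_r}$. Then the Killing equation $\nabla_{(a_0}k_{a_1\cdots a_r)}=0$ (for $\nabla\in\boldsymbol p$) is equivalent to the tractor equation $$\mathbb{D}_{(A_0}K_{A_1\cdots A_r)}=0 .$$
   Context: Conventions. $M$ is a smooth manifold, $\dim M=n\ge 2$. Abstract indices are used; $(\cdots)$ denotes symmetrisation. A projective structure $\boldsymbol{p}=[\nabla]$ is a class of torsion-free affine connections, where $\nabla'\sim\nabla$ iff $\nabla'_a v^b=\nabla_a v^b+\Upsilon_a v^b+\Upsilon_c v^c\delta_a^b$ for some 1-form $\Upsilon$. For $w\in\mathbb{R}$, $\mathcal{E}(w)$ is the $\frac{w}{2n+2}$-th power of the oriented line bundle $(\Lambda^nTM)^{\otimes 2}$; $\mathcal{B}(w):=\mathcal{B}\otimes\mathcal{E}(w)$. Curvature: $[\nabla_a,\nabla_b]v^c=R_{ab}{}^c{}_dv^d$, $R_{bd}=R_{cb}{}^c{}_d$, projective Schouten tensor $\mathsf{P}_{ab}=\frac{1}{n^2-1}(nR_{ab}+R_{ba})$. Tractors. The cotractor bundle is $\mathcal{T}^*=J^1\mathcal{E}(1)$, with canonical sequence $0\to T^*M(1)\xrightarrow{Z_A{}^a}\mathcal{T}^*\xrightarrow{X^A}\mathcal{E}(1)\to 0$.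 A choice $\nabla\in\boldsymbol{p}$ splits the sequence ($j^1\sigma\mapsto(\sigma,\nabla_a\sigma)$), giving $Y_A:\mathcal{E}(1)\to\mathcal{T}^*$ with $X^AY_A=1$. The (projectively invariant) tractor connection on $\mathcal{T}^*$ is $\nabla_a(\sigma,\mu_b)=(\nabla_a\sigma-\mu_a,\ \nabla_a\mu_b+\mathsf{P}_{ab}\sigma)$, extended to tensor powers, and coupled with $\nabla\in\boldsymbol p$ on densities. The Thomas-$\mathbb{D}$ operator on a tractor section $V$ of weight $w$ is the projectively invariant operator $\mathbb{D}_AV=wY_AV+Z_A{}^a\nabla_aV$, of weight $w-1$. Here $K\in\Gamma(S^r\mathcal{T}^*(r))$ has weight $r$. The Killing equation on $S^rT^*M(2r)$ is independent of the choice of $\nabla\in\boldsymbol{p}$. *)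

(* Defs.v *)
From HB Require Import structures.
From mathcomp Require Import all_boot all_order all_algebra all_fingroup.
From mathcomp Require Import all_classical all_reals all_analysis.
Import Order.TTheory GRing.Theory Num.Theory.
Import numFieldNormedType.Exports.

Set Implicit Arguments.
Unset Strict Implicit.
Unset Printing Implicit Defensive.

Local Open Scope classical_set_scope.
Local Open Scope ring_scope.

Section Smooth.
Variables (R : realType) (n : nat).
Implicit Types (A : set 'rV[R]_n) (f : 'rV[R]_n -> R).

Definition pd f (a : 'I_n) : 'rV[R]_n -> R := fun y => 'D_(delta_mx 0 a) f y.

(* All partial derivatives of f of order at most k are (Frechet)
   differentiable at every point of the open set A. *)
Fixpoint smooth_upto k A f : Prop :=
  (forall y, A y -> differentiable f y) /\
  (if k is k'.+1 then forall a, smooth_upto k' A (pd f a) else True).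

Definition smooth_on A f : Prop := forall k, smooth_upto k A f.

End Smooth.

Record manifold (R : realType) (n : nat) := Manifold {
  carrier :> topologicalType ;
  hausdorffM : hausdorff_space carrier ;
  second_countableM : @second_countable carrier ;
  chart : Type ;
  dom : chart -> set carrier ;
  coord : chart -> carrier -> 'rV[R]_n ;
  chart_inv : chart -> 'rV[R]_n -> carrier ;
  dom_open : forall i, open (dom i) ;
  dom_cover : forall x, exists i, dom i x ;
  coord_open : forall i, open (coord i @` dom i) ;
  coordK : forall i x, dom i x -> chart_inv i (coord i x) = x ;
  coord_continuous : forall i, {within dom i, continuous (coord i)} ;
  chart_inv_continuous : forall i, {within coord i @` dom i, continuous (chart_inv i)} ;
  transition_smooth : forall i j c,
    smooth_on (coord i @` (dom i `&` dom j))
              (fun y => coord j (chart_inv i y) 0 c) }.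

Section Bundles.
Variables (R : realType) (n : nat) (M : manifold R n).
Local Notation V := 'rV[R]_n.
Implicit Types (i j : chart M) (y : V).

Definition chart_image i : set V := coord i @` dom i.
Definition overlap i j : set V := coord i @` (dom i `&` dom j).
Definition transition i j : V -> V := fun y => coord j (chart_inv i y).

(* jac i j y b a is the derivative of the b-th coordinate of chart j along the
   a-th coordinate of chart i, at the point of coordinates y in chart i. *)
Definition jac i j y (b a : 'I_n) : R := pd (fun z => transition i j z 0 b) a y.

(* A vector bundle, given by its gluing functions: over each chart it is
   trivialised with fibre coordinates indexed by fib, and
   trans i j y is the matrix from the trivialisation over chart i to the one
   over chart j, at the point of coordinates y in chart i. *)
Record bundle := Bundle {
  fib : finType ;
  trans : chart M -> chart M -> V -> fib -> fib -> R }.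
Arguments trans : clear implicits.

(* Over a chart, a section is represented by its fibre coordinates, as functions
   of the coordinates of the point. *)
Definition components (F : Type) := chart M -> V -> F -> R.

Record section (E : bundle) := Section {
  comp :> chart M -> V -> fib E -> R ;
  section_smooth : forall i e, smooth_on (chart_image i) (fun y => comp i y e) ;
  section_glue : forall i j y e, overlap i j y ->
    comp j (transition i j y) e = \sum_f trans E i j y e f * comp i y f }.

Definition tangent : bundle := @Bundle 'I_n (fun i j y b a => jac i j y b a).

Definition cotangent : bundle :=
  @Bundle 'I_n (fun i j y b a => jac j i (transition i j y) a b).

(* Gluing function of E(w), the w/(2n+2)-th power of (Lambda^n TM)^2, the latter
   being glued by the square of the Jacobian determinant. *)
Definition dens (w : R) i j y : R :=
  ((\det (\matrix_(b, a) jac i j y b a)) ^+ 2) `^ (w / (2 * n + 2)%:R).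

(* E tensored with E(w). *)
Definition twist (E : bundle) (w : R) : bundle :=
  @Bundle (fib E) (fun i j y e f => dens w i j y * trans E i j y e f).

Definition tpow (r : nat) (E : bundle) : bundle :=
  @Bundle {ffun 'I_r -> fib E}
    (fun i j y e f => \prod_(s < r) trans E i j y (e s) (f s)).

(* The cotractor bundle J^1 E(1). Over a chart, the jet of sigma has coordinates
   sigma (index None) and the partial derivatives of sigma (indices Some a); the
   matrix comes from differentiating sigma' = dens 1 * sigma. *)
Definition cotractor : bundle :=
  @Bundle (option 'I_n) (fun i j y A B =>
    match A, B with
    | None, None => dens 1 i j y
    | None, Some _ => 0
    | Some b, None =>
        \sum_a jac j i (transition i j y) a b * pd (dens 1 i j) a y
    | Some b, Some a => jac j i (transition i j y) a b * dens 1 i j y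
    end).

Definition symmetric_components (r : nat) (F : finType)
    (T : components {ffun 'I_r -> F}) : Prop :=
  forall i y (s : 'S_r) (e : {ffun 'I_r -> F}), chart_image i y ->
    T i y [ffun t => e (s t)] = T i y e.

(* Sections of S^r E tensored with E(w). *)
Record sym_section (r : nat) (E : bundle) (w : R) := SymSection {
  sym_sec :> section (twist (tpow r E) w) ;
  sym_sec_sym : symmetric_components (r := r) (F := fib E) sym_sec }.

Definition symmetrize (m : nat) (F : finType) (T : {ffun 'I_m -> F} -> R)
    (e : {ffun 'I_m -> F}) : R :=
  (m`!%:R)^-1 * \sum_(s : 'S_m) T [ffun t => e (s t)].

End Bundles.
Arguments trans {R n M} b _ _ _ _ _.

Section Connections.
Variables (R : realType) (n : nat) (M : manifold R n).
Local Notation V := 'rV[R]_n.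

(* Connection form of a bundle: nabla_a v_e = d_a v_e + sum_f om a e f * v_f. *)
Definition connform (F : Type) := chart M -> V -> 'I_n -> F -> F -> R.

Definition cov (F : finType) (om : connform F) (v : components M F)
    (i : chart M) (y : V) (a : 'I_n) (e : F) : R :=
  pd (fun z => v i z e) a y + \sum_f om i y a e f * v i y f.

(* christoffel i y c a b is Gamma^c_{ab}, with
   nabla_a v^c = d_a v^c + Gamma^c_{ab} v^b. *)
Record tf_connection := TFConnection {
  christoffel : chart M -> V -> 'I_n -> 'I_n -> 'I_n -> R ;
  christoffel_smooth : forall i c a b,
    smooth_on (chart_image i) (fun y => christoffel i y c a b) ;
  christoffel_glue : forall i j y c a b, overlap i j y ->
    let y' := transition i j y in
    christoffel j y' c a b =
      \sum_k jac i j y c k *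
        (\sum_p \sum_q christoffel i y k p q * jac j i y' p a * jac j i y' q b
         + pd (fun z => jac j i z k b) a y') ;
  torsion_free : forall i y c a b, chart_image i y ->
    christoffel i y c a b = christoffel i y c b a }.

Implicit Types nab : tf_connection.

Definition tangent_form nab : connform 'I_n :=
  fun i y a c b => christoffel nab i y c a b.

Definition dual_form (F : Type) (om : connform F) : connform F :=
  fun i y a e f => - om i y a f e.

Definition cotangent_form nab : connform 'I_n := dual_form (tangent_form nab).

(* On Lambda^n TM the connection form is the trace of the one of TM, on its
   square it is twice that, and on E(w) it is w/(2n+2) times the latter. *)
Definition dens_form nab (w : R) (i : chart M) (y : V) (a : 'I_n) : R :=
  w / (2 * n + 2)%:R * (2 * \sum_c tangent_form nab i y a c c).

Definition tensor_form (F G : eqType) (om : connform F) (om' : connform G) :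
    connform (F * G)%type :=
  fun i y a e f => om i y a e.1 f.1 * (e.2 == f.2)%:R
                   + (e.1 == f.1)%:R * om' i y a e.2 f.2.

Definition tpow_form (r : nat) (F : eqType) (om : connform F) :
    connform {ffun 'I_r -> F} :=
  fun i y a e f => \sum_(s < r)
    om i y a (e s) (f s) * \prod_(t < r | t != s) (e t == f t)%:R.

Definition twist_form nab (F : eqType) (om : connform F) (w : R) : connform F :=
  fun i y a e f => om i y a e f + dens_form nab w i y a * (e == f)%:R.

(* nabla'_a v^b = nabla_a v^b + U_a v^b + U_c v^c delta_a^b, for local vector
   fields v. *)
Definition proj_equiv nab nab' : Prop :=
  exists U : section (cotangent M), forall (i : chart M) (v : components M 'I_n),
    (forall b, smooth_on (chart_image i) (fun y => v i y b)) ->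
    forall y a b, chart_image i y ->
      cov (tangent_form nab') v i y a b =
      cov (tangent_form nab) v i y a b + U i y a * v i y b
      + \sum_c U i y c * v i y c * (a == b)%:R.

Record proj_structure := ProjStructure {
  in_class : set tf_connection ;
  is_class : exists nab, in_class = [set nab' | proj_equiv nab nab'] }.

(* R_{ab}^c_d, from [nabla_a, nabla_b] v^c = R_{ab}^c_d v^d applied to the d-th
   coordinate vector field. *)
Definition curvature nab (i : chart M) (y : V) (a b c d : 'I_n) : R :=
  let frame : components M 'I_n := fun _ _ e => (e == d)%:R in
  let nabla_frame : components M ('I_n * 'I_n)%type :=
    fun i' z e => cov (tangent_form nab) frame i' z e.1 e.2 in
  let hess a' b' :=
    cov (tensor_form (cotangent_form nab) (tangent_form nab))
        nabla_frame i y a' (b', c) in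
  hess a b - hess b a.

Definition ricci nab (i : chart M) (y : V) (b d : 'I_n) : R :=
  \sum_c curvature nab i y c b c d.

Definition schouten nab (i : chart M) (y : V) (a b : 'I_n) : R :=
  (n%:R * ricci nab i y a b + ricci nab i y b a) / (n%:R ^+ 2 - 1).

Definition killing nab (r : nat) (k : sym_section r (cotangent M) (2 * r)%:R) :
    Prop :=
  forall i y (e : {ffun 'I_r.+1 -> 'I_n}), chart_image i y ->
    symmetrize (fun e' =>
      cov (twist_form nab (tpow_form (r := r) (cotangent_form nab)) (2 * r)%:R)
          k i y (e' ord0) [ffun s => e' (lift ord0 s)]) e = 0.

End Connections.

Section Tractors.
Variables (R : realType) (n : nat) (M : manifold R n).
Local Notation V := 'rV[R]_n.
Local Notation tidx := (option 'I_n).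
Implicit Types (nab : tf_connection M) (i : chart M) (y : V).

(* X, Y, Z and W in jet coordinates. W is j^1 sigma |-> nabla_a sigma, so that
   (X, W) is the splitting defined by nab and (Y, Z) is its inverse. *)
Definition tX (A : tidx) : R := (A == None)%:R.

Definition tZ (A : tidx) (a : 'I_n) : R := (A == Some a)%:R.

Definition tW nab i y (a : 'I_n) (A : tidx) : R :=
  if A is Some b then (a == b)%:R else dens_form nab 1 i y a.

Definition tY nab i y (A : tidx) : R :=
  if A is Some a then - dens_form nab 1 i y a else 1.

(* In the next two definitions one index refers to jet coordinates and the other
   to the direct sum E(1) + T^*M(1), whose elements (sigma, mu_b) have
   coordinates sigma (index None) and mu_b (indices Some b). *)
Definition split_mx nab i y (B A : tidx) : R :=
  if B is Some a then tW nab i y a A else tX A.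

Definition unsplit_mx nab i y (A B : tidx) : R :=
  if B is Some a then tZ A a else tY nab i y A.

(* nabla_a (sigma, mu_b) = (nabla_a sigma - mu_a, nabla_a mu_b + P_ab sigma) *)
Definition split_tractor_form nab : connform M tidx :=
  fun i y a B C =>
    match B, C with
    | None, None => dens_form nab 1 i y a
    | None, Some c => - (a == c)%:R
    | Some b, None => schouten nab i y a b
    | Some b, Some c => twist_form nab (cotangent_form nab) 1 i y a b c
    end.

Definition tensor_act (r : nat) (S : chart M -> V -> tidx -> tidx -> R)
    (T : components M {ffun 'I_r -> tidx}) : components M {ffun 'I_r -> tidx} :=
  fun i y e =>
    \sum_(f : {ffun 'I_r -> tidx}) (\prod_(s < r) S i y (e s) (f s)) * T i y f.

(* The tractor connection on the r-th tensor power of the cotractor bundle,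
   coupled with nab on E(w), in jet coordinates. *)
Definition tractor_cov nab (r : nat) (w : R)
    (T : components M {ffun 'I_r -> tidx}) (i : chart M) (y : V) (a : 'I_n)
    (e : {ffun 'I_r -> tidx}) : R :=
  tensor_act (unsplit_mx nab)
    (fun i' z f =>
       cov (twist_form nab (tpow_form (r := r) (split_tractor_form nab)) w)
           (tensor_act (split_mx nab) T) i' z a f)
    i y e.

Definition thomasD nab (r : nat) (w : R)
    (T : components M {ffun 'I_r -> tidx}) (i : chart M) (y : V) (A : tidx)
    (e : {ffun 'I_r -> tidx}) : R :=
  w * tY nab i y A * T i y e + \sum_a tZ A a * tractor_cov nab w T i y a e.

Definition tractor_lift_comp (r : nat) (k : components M {ffun 'I_r -> 'I_n}) :
    components M {ffun 'I_r -> tidx} :=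
  fun i y C =>
    \sum_(c : {ffun 'I_r -> 'I_n}) (\prod_(s < r) tZ (C s) (c s)) * k i y c.

Lemma smooth_on0 (A : set V) : smooth_on A (fun=> 0 : R).
Proof.
move=> k; elim: k => [|k IHk] /=; split=> //.
  by move=> a; rewrite /pd; under eq_fun do rewrite derive_cst.
Qed.

Lemma tractor_lift_Some r (k : components M {ffun 'I_r -> 'I_n}) i y C :
  tractor_lift_comp k i y C =
  \sum_(c : {ffun 'I_r -> 'I_n} | C == [ffun s => Some (c s)]) k i y c.
Proof.
rewrite /tractor_lift_comp [RHS]big_mkcond /=; apply: eq_bigr => c _.
case: eqP => [->|neC].
  by rewrite big1 ?mul1r// => s _; rewrite /tZ ffunE eqxx.
suff [s Cs] : exists s, C s != Some (c s).
  by rewrite (bigD1 s)//= /tZ (negbTE Cs) !mul0r.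
apply/existsP; rewrite -negb_forall; apply: contra_notN neC => /forallP CE.
by apply/ffunP => s; rewrite ffunE; apply/eqP.
Qed.

Lemma tractor_lift_smooth r (k : section (twist (tpow r (cotangent M)) (2 * r)%:R))
  i C : smooth_on (chart_image i) (fun y => tractor_lift_comp k i y C).
Proof.
under eq_fun do rewrite tractor_lift_Some.
case: (pickP [pred c : {ffun 'I_r -> 'I_n} | C == [ffun s => Some (c s)]])
    => [c0 /= /eqP ->|noc].
  suff -> : (fun y => \sum_(c : {ffun 'I_r -> 'I_n} | [ffun s => Some (c0 s)] ==
        [ffun s => Some (c s)] :> {ffun 'I_r -> tidx}) k i y c) =
      (fun y => k i y c0) by exact: section_smooth.
  apply: funext => y; rewrite (big_pred1 c0)// => c /=.
  apply/eqP/eqP => [/ffunP E|->//].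
  by apply/ffunP => s; have := E s; rewrite !ffunE => -[].
under eq_fun => y do rewrite big_pred0//.
exact: smooth_on0.
Qed.

Lemma dens_double r i j y :
  dens (2 * r)%:R i j y = dens r%:R i j y * dens 1 i j y ^+ r.
Proof.
rewrite /dens; set d := (_ ^+ 2).
rewrite -powR_mulrn ?powR_ge0// -powRrM mul1r [_^-1 * _]mulrC.
case: r => [|r]; first by rewrite muln0 mul0r powRr0 mulr1.
rewrite -powRD; first by rewrite -mulrDl -natrD addnn mul2n.
by rewrite -mulrDl -natrD mulf_eq0 invr_eq0 !pnatr_eq0 addn2 addSn.
Qed.

Lemma cotractor_tZ i j y A d :
  \sum_B trans (cotractor M) i j y A B * tZ B d =
  \sum_c tZ A c * (trans (cotangent M) i j y c d * dens 1 i j y).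
Proof.
rewrite (bigD1 (Some d))//= big1 ?addr0; last first.
  by move=> B /negbTE Bd; rewrite /tZ Bd mulr0.
rewrite /tZ eqxx mulr1; case: A => [b|]; last first.
  by rewrite big1// => c _; rewrite mul0r.
rewrite (bigD1 b)//= eqxx mul1r big1 ?addr0// => c /negbTE cb.
by rewrite (_ : (Some b == Some c) = false) ?mul0r// eq_sym -cb.
Qed.

Lemma tractor_lift_glue r
    (k : section (twist (tpow r (cotangent M)) (2 * r)%:R)) i j y C :
  overlap i j y ->
  tractor_lift_comp k j (transition i j y) C =
  \sum_D trans (twist (tpow r (cotractor M)) r%:R) i j y C D *
         tractor_lift_comp k i y D.
Proof.
move=> oy; rewrite /tractor_lift_comp.
under eq_bigr do rewrite section_glue// mulr_sumr.
rewrite exchange_big /=.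
under [RHS]eq_bigr do rewrite mulr_sumr.
rewrite [RHS]exchange_big /=; apply: eq_bigr => d _.
under eq_bigr do rewrite !mulrA.
under [RHS]eq_bigr do rewrite !mulrA.
rewrite -!mulr_suml; congr (_ * _).
under [RHS]eq_bigr do rewrite -mulrA -big_split/=.
rewrite -mulr_sumr.
rewrite -(bigA_distr_bigA
  (fun s B => trans (cotractor M) i j y (C s) B * tZ B (d s))) /=.
under [X in _ = _ * X]eq_bigr do rewrite cotractor_tZ.
rewrite bigA_distr_bigA /= mulr_sumr; apply: eq_bigr => c _.
rewrite dens_double !big_split /= prodr_const card_ord.
by rewrite -!mulrA [LHS]mulrCA [_ ^+ r * _]mulrC.
Qed.

(* K = Z ... Z k, a section of S^r T^* tensored with E(r). *)
Definition tractor_lift_section r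
    (k : section (twist (tpow r (cotangent M)) (2 * r)%:R)) :
    section (twist (tpow r (cotractor M)) r%:R) :=
  @Section R n M (twist (tpow r (cotractor M)) r%:R) (tractor_lift_comp k)
    (tractor_lift_smooth k) (tractor_lift_glue k).

Lemma tractor_lift_sym r (k : sym_section r (cotangent M) (2 * r)%:R) :
  symmetric_components (r := r) (F := tidx) (tractor_lift_section k).
Proof.
move=> i y s C iy /=; rewrite /tractor_lift_comp.
rewrite (reindex_inj (h := fun c : {ffun 'I_r -> 'I_n} => [ffun t => c (s t)])) /=.
  apply: eq_bigr => c _; rewrite sym_sec_sym//; congr (_ * _).
  rewrite [RHS](reindex_inj (@perm_inj _ s)) /=.
  by apply: eq_bigr => t _; rewrite !ffunE.
move=> c c' /ffunP E; apply/ffunP => t.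
by have := E ((s^-1)%g t); rewrite !ffunE permKV.
Qed.

Definition tractor_lift r (k : sym_section r (cotangent M) (2 * r)%:R) :
    sym_section r (cotractor M) r%:R :=
  @SymSection R n M r (cotractor M) r%:R _ (tractor_lift_sym k).

(* D_(A0 K_A1...Ar) = 0 *)
Definition tractor_killing nab (r : nat)
    (K : sym_section r (cotractor M) r%:R) : Prop :=
  forall i y (A : {ffun 'I_r.+1 -> tidx}), chart_image i y ->
    symmetrize (fun A' =>
      thomasD nab r%:R K i y (A' ord0) [ffun s => A' (lift ord0 s)]) A = 0.

End Tractors.

(* Main.v *)
(* In the splitting given by nab, the Leibniz rule for the tractor connection
   gives
     D_A K_(C_1...C_r) = Z_A^a Z_(C_1)^(c_1)...Z_(C_r)^(c_r) nabla_a k_(c_1...c_r)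
       + r Y_A K_(C_1...C_r) - sum_s Y_(C_s) K_(C_1...A...C_r),
   where A replaces C_s in the last sum. Exchanging A and C_s turns each term of
   that sum into Y_A K_(C_1...C_r), so the last two terms cancel on symmetrising
   and D_(A K_(C_1...C_r)) is the image of nabla_(a k_(c_1...c_r)) under the
   injective Z ... Z. A projective change by U adds to nabla_a k an expression of
   the same shape, with U and k in place of Y and K, hence the same cancellation
   makes the Killing equation independent of the connection. *)

Require Import Defs.
From HB Require Import structures.
From mathcomp Require Import all_boot all_order all_algebra all_fingroup.
From mathcomp Require Import all_classical all_reals all_analysis.
Import Order.TTheory GRing.Theory Num.Theory.
Import numFieldNormedType.Exports.
From mathcomp Require Import ring.

Set Implicit Arguments.
Unset Strict Implicit.
Unset Printing Implicit Defensive.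

Local Open Scope classical_set_scope.
Local Open Scope ring_scope.

(** * Replacement of one slot of a multi-index, and sums against Kronecker deltas *)

Definition upd (r : nat) (F : Type) (f : {ffun 'I_r -> F}) (s : 'I_r) (c : F) :
    {ffun 'I_r -> F} :=
  [ffun t => if t == s then c else f t].

Lemma sum_delta_l (R : pzRingType) (I : finType) (i : I) (f : I -> R) :
  \sum_j (i == j)%:R * f j = f i.
Proof.
rewrite (bigD1 i)//= eqxx mul1r big1 ?addr0// => j /negbTE ji.
by rewrite eq_sym ji mul0r.
Qed.

Lemma sum_delta_r (R : pzRingType) (I : finType) (i : I) (f : I -> R) :
  \sum_j f j * (j == i)%:R = f i.
Proof.
rewrite (bigD1 i)//= eqxx mulr1 big1 ?addr0// => j /negbTE ji.
by rewrite ji mulr0.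
Qed.

Lemma sum_option (R : pzRingType) (I : finType) (f : option I -> R) :
  \sum_x f x = f None + \sum_j f (Some j).
Proof.
rewrite (bigD1 None)//=; congr (_ + _).
rewrite (reindex_omap Some id)/=; last by case.
by apply: eq_bigl => j; rewrite eqxx.
Qed.

Lemma smooth_on_cst (R : realType) (n : nat) (A : set 'rV[R]_n) (c : R) :
  smooth_on A (fun=> c).
Proof.
case=> [|m] /=; split=> // a.
by rewrite /pd; under eq_fun do rewrite derive_cst; exact: smooth_on0.
Qed.

(** * The cancellation under symmetrisation *)

Section Symmetrize.
Variables (R : realType) (F : finType).

(** Each of the [r] summands symmetrises to that of [Y (f ord0) * T], whence the factor [r]. It is
    applied with [Y] the splitting [tY] and with [Y] the 1-form of a projective change. *)
Lemma symmetrize_transport r (Y : F -> R) (T : {ffun 'I_r -> F} -> R)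
    (e : {ffun 'I_r.+1 -> F}) :
  symmetrize (fun f => r%:R * Y (f ord0) * T [ffun t => f (lift ord0 t)]
    - \sum_s Y (f (lift ord0 s)) *
        T (upd [ffun t => f (lift ord0 t)] s (f ord0))) e = 0.
Proof.
rewrite /symmetrize sumrB exchange_big /=.
rewrite [X in _ - X](_ : _ = \sum_(s < r) \sum_(p : 'S_r.+1)
    Y (e (p ord0)) * T [ffun t => e (p (lift ord0 t))]).
  rewrite sumr_const card_ord -[X in _ - X]mulr_natl mulr_sumr.
  rewrite -sumrB big1 ?mulr0// => p _; apply/eqP; rewrite subr_eq0 mulrA.
  rewrite !ffunE; apply/eqP; congr (_ * T _).
  by apply/ffunP => t; rewrite !ffunE.
apply: eq_bigr => s _.
(* Composing with the transposition (0 s+1) exchanges f_0 and f_(s+1). *)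
rewrite (reindex_inj (mulgI (tperm ord0 (lift ord0 s)))) /=.
apply: eq_bigr => p _; rewrite !ffunE !permM tpermL tpermR.
congr (_ * T _); apply/ffunP => t; rewrite !ffunE !permM.
case: eqP => [->//|/eqP ts]; rewrite tpermD ?neq_lift//.
by rewrite (inj_eq lift_inj) eq_sym.
Qed.

Lemma eq_symmetrize_transport r (Y : F -> R) (T : {ffun 'I_r -> F} -> R)
    (G G' : {ffun 'I_r.+1 -> F} -> R) (e : {ffun 'I_r.+1 -> F}) :
  (forall p : 'S_r.+1, let f := [ffun t => e (p t)] in
    G f = G' f + (r%:R * Y (f ord0) * T [ffun t => f (lift ord0 t)]
      - \sum_s Y (f (lift ord0 s)) *
          T (upd [ffun t => f (lift ord0 t)] s (f ord0)))) ->
  symmetrize G e = symmetrize G' e.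
Proof.
move=> GG'; rewrite -[RHS]addr0 -[X in _ = _ + X](symmetrize_transport Y T e).
by rewrite -mulrDr -big_split; congr (_ * _); apply: eq_bigr => p _; exact: GG'.
Qed.

End Symmetrize.

(** * The Leibniz rule on twisted tensor powers *)

Section Forms.
Variables (R : realType) (n : nat) (M : manifold R n).

(** The deltas in [tpow_form] keep only the [g] that agree with [f] outside slot [s]; the entry [c]
    of [g] in that slot parametrises them. *)
Lemma sum_tpow_form r (F : finType) (om : connform M F) i y a
    (T : {ffun 'I_r -> F} -> R) (f : {ffun 'I_r -> F}) :
  \sum_g tpow_form (r := r) om i y a f g * T g =
  \sum_s \sum_c om i y a (f s) c * T (upd f s c).
Proof.
under eq_bigr do rewrite /tpow_form mulr_suml.
rewrite exchange_big /=; apply: eq_bigr => s _.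
rewrite (partition_big (fun g : {ffun 'I_r -> F} => g s) predT)//=.
apply: eq_bigr => c _; rewrite (bigD1 (upd f s c)) ?ffunE ?eqxx//=.
rewrite [X in _ + X]big1 ?addr0 => [|g /andP[/eqP gs gf]].
  rewrite big1 ?mulr1// => t /negbTE ts.
  by rewrite ffunE ts eqxx.
have [t /andP[ts ft]] : exists t, (t != s) && (f t != g t).
  apply/existsP; apply: contraNT gf; rewrite negb_exists => /forallP fg.
  apply/eqP/ffunP => t; rewrite ffunE; case: eqP => [->//|/eqP ts].
  by have := fg t; rewrite ts/= negbK => /eqP.
by rewrite (bigD1 t)//= (negbTE ft) mul0r mulr0 mul0r.
Qed.

Lemma cov_twist_tpow (nab : tf_connection M) r (F : finType)
    (om : connform M F) w (v : components M {ffun 'I_r -> F}) i y a f :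
  cov (twist_form nab (tpow_form (r := r) om) w) v i y a f =
  pd (fun z => v i z f) a y
  + \sum_s \sum_c om i y a (f s) c * v i y (upd f s c)
  + dens_form nab w i y a * v i y f.
Proof.
rewrite /cov /twist_form; under eq_bigr do rewrite mulrDl -mulrA.
by rewrite big_split /= sum_tpow_form -mulr_sumr sum_delta_l addrA.
Qed.

Lemma dens_formZ (nab : tf_connection M) w i y a :
  dens_form nab w i y a = w * dens_form nab 1 i y a.
Proof. by rewrite /dens_form mul1r !mulrA. Qed.

End Forms.

(** * Projective invariance of the Killing equation *)

Section ProjectiveChange.
Variables (R : realType) (n : nat) (M : manifold R n).
Implicit Types nab : tf_connection M.

(** Testing the equivalence on the [b]-th coordinate field, whose components are constant, isolates
    the Christoffel symbols. *)
Lemma proj_equiv_christoffel nab nab' : proj_equiv nab nab' ->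
  exists U : chart M -> 'rV[R]_n -> 'I_n -> R,
  forall i y c a b, chart_image i y ->
    christoffel nab' i y c a b = christoffel nab i y c a b
      + U i y a * (c == b)%:R + U i y b * (a == c)%:R.
Proof.
move=> [U eqU]; exists U => i y c a b iy.
have := eqU i (fun _ _ e => (e == b)%:R) (fun e => @smooth_on_cst _ _ _ _)
  y a c iy.
rewrite /cov /tangent_form /pd derive_cst !add0r !sum_delta_r => ->.
congr (_ + _); rewrite -(sum_delta_r b (fun d => U i y d * (a == c)%:R)).
by apply: eq_bigr => d _; rewrite mulrAC.
Qed.

(** The trace of the change of the Christoffel symbols is $(n+1)U_a$, and $\frac{w}{2n+2}\cdot
    2(n+1) = w$. *)
Lemma dens_form_change nab nab' (U : 'I_n -> R) w i y a :
  (forall c b, christoffel nab' i y c a b = christoffel nab i y c a b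
      + U a * (c == b)%:R + U b * (a == c)%:R) ->
  dens_form nab' w i y a = dens_form nab w i y a + w * U a.
Proof.
move=> eqU; rewrite /dens_form /tangent_form; under eq_bigr do rewrite eqU eqxx.
rewrite !big_split /= sumr_const card_ord.
have -> : \sum_(c < n) U c * (a == c)%:R = U a.
  by rewrite -(sum_delta_l a U); apply: eq_bigr => c _; rewrite mulrC.
have n1 : (2 * n + 2)%:R != 0 :> R by rewrite pnatr_eq0 addn2.
rewrite mulrDr mulr1 -mulr_natr; set G := \sum_(_ < _) _.
move: n1; rewrite natrD natrM => n1; by field.
Qed.

(** The weight contributes $2rU_a k$ and each of the [r] covector slots removes one $U_a k$ and one
    exchanged term. What is left, $rU_a k$ minus the exchanged terms, vanishes by
    [symmetrize_transport]. *)
Lemma killing_proj_equiv nab nab' r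
    (k : sym_section r (cotangent M) (2 * r)%:R) :
  proj_equiv nab nab' -> killing nab k <-> killing nab' k.
Proof.
move=> /proj_equiv_christoffel[U eqU].
suff E i y (e : {ffun 'I_r.+1 -> 'I_n}) : chart_image i y ->
  symmetrize (fun e' =>
    cov (twist_form nab' (tpow_form (r := r) (cotangent_form nab')) (2 * r)%:R)
        k i y (e' ord0) [ffun s => e' (lift ord0 s)]) e =
  symmetrize (fun e' =>
    cov (twist_form nab (tpow_form (r := r) (cotangent_form nab)) (2 * r)%:R)
        k i y (e' ord0) [ffun s => e' (lift ord0 s)]) e.
  by split=> H i y e iy; have := H i y e iy; rewrite E.
move=> iy; apply: (@eq_symmetrize_transport R _ r (U i y) (k i y) _ _ e) => p f.
set a := f ord0; set b := [ffun s => _].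
rewrite !cov_twist_tpow (dens_form_change _ (fun c b => eqU i y c a b iy)).
rewrite (_ : \sum_(s < r) \sum_c cotangent_form nab' i y a (b s) c *
    k i y (upd b s c) = \sum_s (\sum_c cotangent_form nab i y a (b s) c *
    k i y (upd b s c) - (U i y a * k i y b + U i y (b s) * k i y (upd b s a)))).
  rewrite sumrB big_split /= sumr_const card_ord.
  have -> : \sum_s U i y (f (lift ord0 s)) * k i y (upd b s a) =
      \sum_s U i y (b s) * k i y (upd b s a).
    by apply: eq_bigr => s _; rewrite /b ffunE.
  ring.
apply: eq_bigr => s _.
(* Both correction terms become sums over [c] against deltas, so that the identity can be checked
   term by term. *)
rewrite -[X in U i y a * k i y X](_ : upd b s (b s) = b); last first.
  by apply/ffunP => t; rewrite [LHS]ffunE; case: eqP => [->|].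
rewrite -(sum_delta_l (b s) (fun c => U i y a * k i y (upd b s c))).
rewrite -(sum_delta_l a (fun c => U i y (b s) * k i y (upd b s c))).
rewrite -big_split -sumrB; apply: eq_bigr => c _ /=.
rewrite /cotangent_form /dual_form /tangent_form eqU// [c == _]eq_sym; ring.
Qed.

End ProjectiveChange.

(** * Tractor derivatives of the lift of [k] *)

Section Lift.
Variables (R : realType) (n : nat) (M : manifold R n).
Local Notation tidx := (option 'I_n).
Implicit Types (nab : tf_connection M).

Lemma tractor_lift_compE r (k : components M {ffun 'I_r -> 'I_n}) i y
    (c : {ffun 'I_r -> 'I_n}) :
  tractor_lift_comp k i y [ffun s => Some (c s)] = k i y c.
Proof.
rewrite tractor_lift_Some (big_pred1 c)// => d /=.
apply/eqP/eqP => [/ffunP E|->//].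
by apply/ffunP => s; have := E s; rewrite !ffunE => -[].
Qed.

Lemma tractor_lift_comp_None r (k : components M {ffun 'I_r -> 'I_n}) i y
    (C : {ffun 'I_r -> tidx}) s :
  C s = None -> tractor_lift_comp k i y C = 0.
Proof.
move=> Cs; rewrite /tractor_lift_comp big1// => c _.
by rewrite (bigD1 s)//= /tZ Cs !mul0r.
Qed.

(** The two cases in which a component of a lift is known: a component of [k], or zero. *)
Variant tidx_spec r : {ffun 'I_r -> tidx} -> Prop :=
| TidxSome (c : {ffun 'I_r -> 'I_n}) : tidx_spec [ffun s => Some (c s)]
| TidxNone (C : {ffun 'I_r -> tidx}) s : C s = None -> tidx_spec C.

Lemma tidxP r (C : {ffun 'I_r -> tidx}) : tidx_spec C.
Proof.
have [/existsP[s /eqP Cs]|] := boolP [exists s, C s == None].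
  exact: TidxNone Cs.
rewrite negb_exists => /forallP CS.
have E s : {c | C s = Some c} by have := CS s; case: (C s) => // c _; exists c.
rewrite (_ : C = [ffun s => Some ([ffun s => sval (E s)] s)]); first exact: TidxSome.
by apply/ffunP => s; rewrite !ffunE; exact: svalP (E s).
Qed.

Lemma upd_Some r (c : {ffun 'I_r -> 'I_n}) s a :
  upd [ffun t => Some (c t)] s (Some a) = [ffun t => Some (upd c s a t)].
Proof. by apply/ffunP => t; rewrite !ffunE; case: ifP. Qed.

(** The subbundle $T^*M(1)$ is embedded in the same way in jet and in split coordinates, so a change
    between them fixes lifts. The equality is one of functions because [cov] differentiates them. *)
Lemma tensor_act_lift r (S : chart M -> 'rV[R]_n -> tidx -> tidx -> R)
    (k : components M {ffun 'I_r -> 'I_n}) :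
  (forall i y A b, S i y A (Some b) = tZ R A b) ->
  tensor_act S (tractor_lift_comp k) = tractor_lift_comp k.
Proof.
move=> SZ; apply/funext => i; apply/funext => y; apply/funext => e.
rewrite /tensor_act /tractor_lift_comp.
under eq_bigr do rewrite mulr_sumr.
rewrite exchange_big /=; apply: eq_bigr => c _.
under eq_bigr do rewrite mulrA -big_split/=.
rewrite -mulr_suml -(bigA_distr_bigA (fun s B => S i y (e s) B * tZ R B (c s))).
congr (_ * _); apply: eq_bigr => s _.
by rewrite /tZ sum_delta_r SZ.
Qed.

Lemma split_mx_Z nab i y A b : split_mx nab i y A (Some b) = tZ R A b.
Proof. by case: A. Qed.

(** On $(0,\mu_b)$ the tractor connection gives $(-\mu_a, \nabla_a\mu_b)$; the correction sum
    collects the entries $-\mu_a$, which appear in the slots equal to [None]. *)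
Lemma cov_split_lift nab r (k : components M {ffun 'I_r -> 'I_n}) i y a
    (f : {ffun 'I_r -> tidx}) :
  cov (twist_form nab (tpow_form (r := r) (split_tractor_form nab)) r%:R)
    (tractor_lift_comp k) i y a f =
  tractor_lift_comp (fun i y => cov (twist_form nab
    (tpow_form (r := r) (cotangent_form nab)) (2 * r)%:R) k i y a) i y f
  - \sum_s (f s == None)%:R * tractor_lift_comp k i y (upd f s (Some a)).
Proof.
rewrite cov_twist_tpow; case: (tidxP f) => {f} [c|f s0 fs0].
  under eq_fun do rewrite tractor_lift_compE.
  rewrite !tractor_lift_compE cov_twist_tpow.
  rewrite [X in _ - X]big1 ?subr0; last by move=> s _; rewrite ffunE mul0r.
  (* Weight [r] from the twist and weight 1 from each of the [r] cotractor slots add up to the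
     weight [2 * r] of [k]. *)
  rewrite (dens_formZ _ r%:R) (dens_formZ _ (2 * r)%:R).
  rewrite (_ : \sum_(s < r) _ = \sum_(s < r) (\sum_d
    cotangent_form nab i y a (c s) d * k i y (upd c s d)
    + dens_form nab 1 i y a * k i y c)).
    by rewrite big_split /= sumr_const card_ord -mulr_natl natrM; ring.
  apply: eq_bigr => s _; rewrite sum_option /=.
  rewrite (@tractor_lift_comp_None _ _ _ _ _ s) ?mulr0 ?add0r; last first.
    by rewrite ffunE eqxx.
  under eq_bigr do rewrite upd_Some tractor_lift_compE ffunE mulrDl -mulrA.
  rewrite big_split /= -mulr_sumr sum_delta_l.
  by congr (_ + _ * k i y _); apply/ffunP => t; rewrite ffunE; case: eqP => [->|].
(* The component at [f] vanishes identically, so its derivative does too; only the connection form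
   acting on a [None] slot can contribute. *)
under eq_fun do rewrite (tractor_lift_comp_None _ _ _ fs0).
rewrite !(tractor_lift_comp_None _ _ _ fs0) mulr0 addr0 /pd derive_cst !add0r.
rewrite -sumrN; apply: eq_bigr => s _.
rewrite sum_option /= (@tractor_lift_comp_None _ _ _ _ _ s) ?ffunE ?eqxx//.
rewrite mulr0 add0r; case fs : (f s) => [b|] /=.
  rewrite mul0r oppr0 big1// => d _.
  rewrite (@tractor_lift_comp_None _ _ _ _ _ s0) ?mulr0// ffunE fs0.
  by case: eqP => // s0s; rewrite -s0s fs0 in fs.
rewrite mul1r; under eq_bigr do rewrite mulNr.
by rewrite sumrN sum_delta_l.
Qed.

(** The column [None] of [unsplit_mx] is [tY], so returning to jet coordinates turns the factor
    [f s == None] into $Y_{e_s}$. *)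
Lemma tractor_cov_lift nab r (k : components M {ffun 'I_r -> 'I_n}) i y a
    (e : {ffun 'I_r -> tidx}) :
  tractor_cov nab r%:R (tractor_lift_comp k) i y a e =
  tractor_lift_comp (fun i y => cov (twist_form nab
    (tpow_form (r := r) (cotangent_form nab)) (2 * r)%:R) k i y a) i y e
  - \sum_s tY nab i y (e s) * tractor_lift_comp k i y (upd e s (Some a)).
Proof.
rewrite /tractor_cov (tensor_act_lift _ (@split_mx_Z nab)) {1}/tensor_act.
under eq_bigr do rewrite cov_split_lift mulrBr.
rewrite sumrB; congr (_ - _).
  have SZ j z A b : unsplit_mx nab j z A (Some b) = tZ R A b by [].
  exact: (congr1 (fun T => T i y e) (tensor_act_lift _ SZ)).
under eq_bigr do rewrite mulr_sumr.
rewrite exchange_big /=; apply: eq_bigr => s _; rewrite /tractor_lift_comp.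
under eq_bigr do rewrite !mulr_sumr.
rewrite exchange_big mulr_sumr /=; apply: eq_bigr => c _.
under eq_bigr do rewrite !mulrA.
rewrite -mulr_suml mulrA; congr (_ * _).
(* [G] gathers the factors slot by slot, so that the sum over multi-indices becomes a product of
   one-slot sums: slot [s] yields [tY], the others [tZ]. *)
pose G t B := if t == s then (B == None)%:R * tZ R (Some a) (c t) else tZ R B (c t).
rewrite (eq_bigr (fun f : {ffun 'I_r -> tidx} =>
    \prod_t (unsplit_mx nab i y (e t) (f t) * G t (f t)))); last first.
  move=> f _; rewrite big_split /= -mulrA; congr (_ * _).
  rewrite [RHS](bigD1 s)//= [in LHS](bigD1 s)//= /G ffunE eqxx mulrA.
  by congr (_ * _); apply: eq_bigr => t /negbTE ts; rewrite ffunE ts.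
rewrite -(bigA_distr_bigA (fun t B => unsplit_mx nab i y (e t) B * G t B)) /=.
rewrite [LHS](bigD1 s)//= [in RHS](bigD1 s)//= mulrA; congr (_ * _).
  rewrite /G ffunE eqxx; under eq_bigr do rewrite mulrA.
  by rewrite -mulr_suml sum_delta_r.
apply: eq_bigr => t /negbTE ts; rewrite /G ts ffunE ts.
by rewrite /tZ sum_delta_r.
Qed.

Lemma sum_tZ_upd r (k : components M {ffun 'I_r -> 'I_n}) i y
    (e : {ffun 'I_r -> tidx}) s A :
  \sum_a tZ R A a * tractor_lift_comp k i y (upd e s (Some a)) =
  tractor_lift_comp k i y (upd e s A).
Proof.
case: A => [b|]; first exact: (sum_delta_l b).
rewrite (@tractor_lift_comp_None _ _ _ _ _ s) ?ffunE ?eqxx//.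
by rewrite big1// => a _; rewrite mul0r.
Qed.

Lemma thomasD_lift nab r (k : components M {ffun 'I_r -> 'I_n}) i y A
    (e : {ffun 'I_r -> tidx}) :
  thomasD nab r%:R (tractor_lift_comp k) i y A e =
  \sum_a tZ R A a * tractor_lift_comp (fun i y => cov (twist_form nab
    (tpow_form (r := r) (cotangent_form nab)) (2 * r)%:R) k i y a) i y e
  + (r%:R * tY nab i y A * tractor_lift_comp k i y e
  - \sum_s tY nab i y (e s) * tractor_lift_comp k i y (upd e s A)).
Proof.
rewrite /thomasD; under eq_bigr do rewrite tractor_cov_lift mulrBr.
rewrite sumrB addrCA; congr (_ + (_ - _)).
under eq_bigr do rewrite mulr_sumr.
rewrite exchange_big /=; apply: eq_bigr => s _; rewrite -sum_tZ_upd mulr_sumr.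
by apply: eq_bigr => a _; rewrite mulrCA.
Qed.

Lemma symmetrize_thomasD_lift nab r (k : components M {ffun 'I_r -> 'I_n})
    i y (A : {ffun 'I_r.+1 -> tidx}) :
  symmetrize (fun A' => thomasD nab r%:R (tractor_lift_comp k) i y (A' ord0)
    [ffun s => A' (lift ord0 s)]) A =
  symmetrize (fun A' => \sum_a tZ R (A' ord0) a *
    tractor_lift_comp (fun i y => cov (twist_form nab
      (tpow_form (r := r) (cotangent_form nab)) (2 * r)%:R) k i y a) i y
        [ffun s => A' (lift ord0 s)]) A.
Proof.
apply: (@eq_symmetrize_transport R _ r (tY nab i y)
  (tractor_lift_comp k i y) _ _ A) => p f.
rewrite thomasD_lift.
by congr (_ + (_ - _)); apply: eq_bigr => s _; rewrite [in LHS]ffunE.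
Qed.

(** Components with all indices of the form [Some] reproduce the Killing equation; the remaining
    ones vanish identically. *)
Lemma tractor_killing_lift nab r
    (k : sym_section r (cotangent M) (2 * r)%:R) :
  killing nab k <-> tractor_killing nab (tractor_lift k).
Proof.
have SomeE i y (e : {ffun 'I_r.+1 -> 'I_n}) :
  symmetrize (fun A' => thomasD nab r%:R (tractor_lift_comp k) i y (A' ord0)
    [ffun s => A' (lift ord0 s)]) [ffun s => Some (e s)] =
  symmetrize (fun e' =>
    cov (twist_form nab (tpow_form (r := r) (cotangent_form nab)) (2 * r)%:R)
        k i y (e' ord0) [ffun s => e' (lift ord0 s)]) e.
  rewrite symmetrize_thomasD_lift; congr (_ * _); apply: eq_bigr => p _.
  set f := [ffun t => e (p t)].
  have -> : [ffun t => [ffun s => Some (e s)] (p t)] = [ffun t => Some (f t)].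
    by apply/ffunP => t; rewrite !ffunE.
  have -> : [ffun s => [ffun t => Some (f t)] (lift ord0 s)] =
      [ffun s => Some ([ffun t => f (lift ord0 t)] s)].
    by apply/ffunP => t; rewrite !ffunE.
  under eq_bigr do rewrite tractor_lift_compE.
  by rewrite [X in tZ R X](ffunE _ ord0) /tZ sum_delta_l.
split=> [kil i y A iy|kil i y e iy]; last by rewrite -SomeE; exact: kil.
case: (tidxP A) => {A} [e|A s As]; first by rewrite [LHS]SomeE kil.
rewrite [LHS]symmetrize_thomasD_lift /symmetrize big1 ?mulr0// => p _.
rewrite big1// => a _.
(* After permuting by [p], the [None] index sits either in slot 0, where [tZ] vanishes, or in a slot
   of the lift, which then vanishes. *)
case: (unliftP ord0 ((p^-1)%g s)) => [t|] /(congr1 p); rewrite permKV => sE.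
  by rewrite (@tractor_lift_comp_None _ _ _ _ _ t) ?mulr0// !ffunE -sE.
by rewrite ffunE -sE As mul0r.
Qed.

End Lift.

Theorem proposition6 (R : realType) (n : nat) (hn : (2 <= n)%N)
    (M : manifold R n) (p : proj_structure M) (r : nat) (hr : (1 <= r)%N)
    (k : sym_section r (cotangent M) ((2 * r)%:R)%R)
    (nab : tf_connection M) (hnab : in_class p nab)
    (nab' : tf_connection M) (hnab' : in_class p nab') :
  killing nab k <-> tractor_killing nab' (tractor_lift k).
Proof.
(* The Killing equations of [nab] and [nab'] are compared through the representative [nab0] that
   defines the class. *)
have [nab0 pE] := is_class p; move: hnab hnab'; rewrite pE => nabE nabE'.
by rewrite -tractor_killing_lift -(killing_proj_equiv k nabE)
  (killing_proj_equiv k nabE').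
Qed.
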